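(* The metric space $\big(\mathcal{P}_1(\mathbb{R}),\mathcal{Q}_{1,1}\big)$ is complete.
   Context: $\mathcal{P}_1(\mathbb{R})$ is the set of Borel probability measures on $\mathbb{R}$ with finite first moment. For $\mu\in\mathcal{P}_1(\mathbb{R})$ and $x\in\mathbb{R}$, $e_{1,1}(\mu,x)=\int_{\mathbb{R}}|\xi-x|\,\mu(d\xi)$, and $\mathcal{Q}_{1,1}(\mu,\nu)=\sup_{x\in\mathbb{R}}|e_{1,1}(\mu,x)-e_{1,1}(\nu,x)|$, which is a distance on $\mathcal{P}_1(\mathbb{R})$. *)

(* Defs.v *)
From HB Require Import structures.
From mathcomp Require Import all_boot all_order all_algebra.
From mathcomp Require Import all_classical all_reals all_analysis.
From mathcomp Require Import measurable_realfun ring lra.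

Set Implicit Arguments.
Unset Strict Implicit.
Unset Printing Implicit Defensive.

Import Order.TTheory GRing.Theory Num.Theory.
Import numFieldNormedType.Exports.

Local Open Scope classical_set_scope.
Local Open Scope ring_scope.

(* A [probability] is a function on all subsets of R whose values on
   non-measurable sets are unconstrained.  [P1_out] fixes these values to 0, so
   that Leibniz equality on [P1 R] is equality of measures on Borel sets
   ([P1_eq]); no measure is lost ([P1_repr]). *)
Record P1 (R : realType) := MkP1 {
  P1_prob :> probability (measurableTypeR R) R ;
  P1_moment : (\int[P1_prob]_xi `|xi|%:E < +oo)%E ;
  P1_out : forall A : set (measurableTypeR R),
    ~ measurable A -> P1_prob A = 0%E
}.

HB.instance Definition _ (R : realType) := gen_eqMixin (P1 R).
HB.instance Definition _ (R : realType) := gen_choiceMixin (P1 R).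

Definition e11 (R : realType) (mu : P1 R) (x : R) : R :=
  (\int[mu]_xi `|xi - x|)%R.

(* The supremum is taken over a nonempty bounded set of reals, see
   [Q11_has_sup]. *)
Definition Q11 (R : realType) (mu nu : P1 R) : R :=
  sup [set `|e11 mu x - e11 nu x| | x in [set: R]].

Lemma probability_eq d (T : measurableType d) (R : realType)
  (p q : probability T R) : p = q :> (set T -> \bar R) -> p = q.
Proof.
move: p q => [m [[a1 a2] [a3] [a4] [a5] [a6] [a7] [a8]]]
             [n [[b1 b2] [b3] [b4] [b5] [b6] [b7] [b8]]] /= e.
subst n; rewrite (_ : a1 = b1)// (_ : a2 = b2)// in a3 *.
by rewrite (_ : a3 = b3)// (_ : a4 = b4)// (_ : a5 = b5)// (_ : a6 = b6)//
   (_ : a7 = b7)// (_ : a8 = b8).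
Qed.

Lemma P1_eq (R : realType) (mu nu : P1 R) :
  (forall A : set (measurableTypeR R), measurable A -> mu A = nu A) -> mu = nu.
Proof.
move=> h; have E : P1_prob mu = P1_prob nu.
  apply: probability_eq; apply/funext => A.
  by have [mA|nA] := pselect (measurable A); [exact: h | rewrite !P1_out].
case: mu nu E {h} => [m m1 m2] [n n1 n2] /= E.
by subst n; rewrite (_ : m1 = n1)// (_ : m2 = n2).
Qed.

Section P1_repr.
Variables (R : realType) (p : probability (measurableTypeR R) R).

Let m (A : set (measurableTypeR R)) : \bar R :=
  if `[< measurable A >] then p A else 0%E.

Let mE A : measurable A -> m A = p A.
Proof. by move=> mA; rewrite /m asboolT. Qed.

Let m0 : m set0 = 0%E. Proof. by rewrite mE// measure0. Qed.

Let m_ge0 A : (0 <= m A)%E. Proof. by rewrite /m; case: ifP. Qed.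

Let m_sigma : semi_sigma_additive m.
Proof.
move=> F mF tF mUF; rewrite mE//.
under eq_fun do under eq_bigr do rewrite mE//.
exact: measure_semi_sigma_additive.
Qed.

HB.instance Definition _ := isMeasure.Build _ _ _ m m0 m_ge0 m_sigma.

Let m1 : m setT = 1%E. Proof. by rewrite mE// probability_setT. Qed.

HB.instance Definition _ := Measure_isProbability.Build _ _ _ m m1.

Lemma P1_repr : (\int[p]_xi `|xi|%:E < +oo)%E ->
  exists mu : P1 R, forall A, measurable A -> mu A = p A.
Proof.
move=> pfin.
have m_fin : (\int[m]_xi `|xi|%:E < +oo)%E.
  by rewrite (eq_measure_integral p)// => A mA _; exact: mE.
have m_out (A : set (measurableTypeR R)) : ~ measurable A -> m A = 0%E.
  by move=> nA; rewrite /m asboolF.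
by exists (MkP1 m_fin m_out) => A mA; exact: mE.
Qed.

End P1_repr.

Section Q11_metric.
Variable R : realType.
Implicit Types (mu nu rho : P1 R) (x y : R).

Lemma P1_integrable_dist mu x :
  mu.-integrable setT (fun xi => `|xi - x|%:E).
Proof.
have i0 : mu.-integrable setT (fun xi => `|xi|%:E).
  apply/integrableP; split.
    by apply/measurable_EFinP; exact: normr_measurable.
  under eq_integral do rewrite abse_EFin normr_id.
  exact: P1_moment.
have ic : mu.-integrable setT (fun=> `|x|%:E).
  exact: (finite_measure_integrable_cst mu `|x|).
apply: (le_integrable _ _ _ (integrableD _ i0 ic)) => //=.
  apply/measurable_EFinP; apply: measurableT_comp => //.
  exact: measurable_funB.
move=> xi _; rewrite lee_fin normr_id [leRHS]ger0_norm ?addr_ge0//.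
exact: ler_normB.
Qed.

Lemma P1_integrable_cst mu x : mu.-integrable setT (fun=> x%:E).
Proof. exact: (finite_measure_integrable_cst mu x). Qed.

Let P1_integrableD mu (f g : R -> R) :
  mu.-integrable setT (fun xi => (f xi)%:E) ->
  mu.-integrable setT (fun xi => (g xi)%:E) ->
  mu.-integrable setT (fun xi => (f xi + g xi)%:E).
Proof. by move=> hf hg; exact: (integrableD _ hf hg). Qed.

Lemma P1_Rintegral_cst mu x : (\int[mu]_xi x)%R = x.
Proof.
by rewrite Rintegral_cst//= probability_setT /= mulr1.
Qed.

Lemma e11_lip mu x y : e11 mu x <= e11 mu y + `|x - y|.
Proof.
rewrite -[X in _ + X](P1_Rintegral_cst mu) /e11 -RintegralD//; last 2 first.
- exact: P1_integrable_dist.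
- exact: P1_integrable_cst.
apply: le_Rintegral => //.
- exact: P1_integrable_dist.
- apply: P1_integrableD; first exact: P1_integrable_dist.
  exact: P1_integrable_cst.
- by move=> xi _; rewrite (distrC x); exact: ler_distD.
Qed.

Lemma norm_le_e11 mu x : `|x| <= e11 mu x + e11 mu 0.
Proof.
rewrite -[X in X <= _](P1_Rintegral_cst mu) /e11 -RintegralD//; last 2 first.
- exact: P1_integrable_dist.
- exact: P1_integrable_dist.
apply: le_Rintegral => //.
- exact: P1_integrable_cst.
- by apply: P1_integrableD; exact: P1_integrable_dist.
- move=> xi _; rewrite subr0 (distrC xi) -{1}(subrK xi x).
  exact: ler_normD.
Qed.

Lemma Q11_has_sup mu nu :
  has_sup [set `|e11 mu x - e11 nu x| | x in [set: R]].
Proof.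
split; first by exists `|e11 mu 0 - e11 nu 0|, 0.
exists (e11 mu 0 + e11 nu 0) => _ [x _ <-]; rewrite ler_norml.
have := (e11_lip mu x 0, e11_lip nu x 0); rewrite subr0 => -[a b].
have := norm_le_e11 mu x; have := norm_le_e11 nu x => c d.
by apply/andP; split; lra.
Qed.

Lemma Q11_ge mu nu x : `|e11 mu x - e11 nu x| <= Q11 mu nu.
Proof.
by apply: (ub_le_sup (Q11_has_sup mu nu).2); exists x.
Qed.

Lemma Q11_le mu nu r :
  (forall x, `|e11 mu x - e11 nu x| <= r) -> Q11 mu nu <= r.
Proof.
move=> h; apply: ge_sup; first exact: (Q11_has_sup mu nu).1.
by move=> _ [x _ <-].
Qed.

Lemma Q11xx mu : Q11 mu mu = 0.
Proof.
apply/le_anti/andP; split; first by apply: Q11_le => x; rewrite subrr normr0.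
by apply: le_trans (Q11_ge mu mu 0).
Qed.

Lemma Q11_sym mu nu : Q11 mu nu = Q11 nu mu.
Proof.
apply/le_anti/andP; split; apply: Q11_le => x; rewrite distrC; exact: Q11_ge.
Qed.

Lemma Q11_triangle nu mu rho : Q11 mu rho <= Q11 mu nu + Q11 nu rho.
Proof.
apply: Q11_le => x; apply: le_trans (ler_distD (e11 nu x) _ _) _.
by apply: lerD; exact: Q11_ge.
Qed.

Let half x : set (measurableTypeR R) := `]-oo, x]%classic.
Let F mu x : R := fine (mu (half x)).

Let mhalf x : measurable (half x). Proof. exact: measurable_itv. Qed.

Let FK mu x : (F mu x)%:E = mu (half x).
Proof. by rewrite fineK// fin_num_measure. Qed.

Let F_indic mu x : (\int[mu]_xi (\1_(half x) xi : R))%R = F mu x.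
Proof. by rewrite /Rintegral integral_indic// setIT. Qed.

Let indic_integrable mu x :
  mu.-integrable setT (fun xi => (\1_(half x) xi : R)%:E).
Proof. exact: integrable_indic. Qed.

Let lin_integrable mu x h :
  mu.-integrable setT (fun xi => (2 * h * \1_(half x) xi)%:E).
Proof.
exact: (integrableZl measurableT (2 * h) (indic_integrable mu x)).
Qed.

Let lin_Rintegral mu x h :
  (\int[mu]_xi (2 * h * \1_(half x) xi))%R = 2 * h * F mu x.
Proof.
rewrite -F_indic; apply: (RintegralZl (f := \1_(half x))) => //.
exact: indic_integrable.
Qed.

(* The slope of e11 mu on [x, x + h] lies between 2 F(x) - 1 and
   2 F(x + h) - 1, where F is the distribution function of mu. *)
Let e11_slope_le mu x (h : R) : 0 < h ->
  e11 mu (x + h) + h <= e11 mu x + 2 * h * F mu (x + h).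
Proof.
move=> h0; rewrite -{2}(P1_Rintegral_cst mu h) -lin_Rintegral /e11.
rewrite -!RintegralD//; try exact: P1_integrable_dist;
  try exact: P1_integrable_cst; last exact: lin_integrable.
apply: le_Rintegral => //.
- apply: P1_integrableD; first exact: P1_integrable_dist.
  exact: P1_integrable_cst.
- apply: P1_integrableD; first exact: P1_integrable_dist.
  exact: lin_integrable.
move=> xi _; rewrite indicE /half mem_setE in_itv/=.
have [xix|xix] := leP xi (x + h).
  rewrite mulr1 (ler0_norm (_ : xi - (x + h) <= 0)) ?subr_le0//.
  have := ler_norm (- (xi - x)); rewrite normrN; lra.
rewrite mulr0 !ger0_norm; lra.
Qed.

Let e11_slope_ge mu x (h : R) : 0 < h ->
  e11 mu x + 2 * h * F mu x <= e11 mu (x + h) + h.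
Proof.
move=> h0; rewrite -{3}(P1_Rintegral_cst mu h) -lin_Rintegral /e11.
rewrite -!RintegralD//; try exact: P1_integrable_dist;
  try exact: P1_integrable_cst; last exact: lin_integrable.
apply: le_Rintegral => //.
- apply: P1_integrableD; first exact: P1_integrable_dist.
  exact: lin_integrable.
- apply: P1_integrableD; first exact: P1_integrable_dist.
  exact: P1_integrable_cst.
move=> xi _; rewrite indicE /half mem_setE in_itv/=.
have [xix|xix] := leP xi x.
  rewrite mulr1 !ler0_norm; lra.
rewrite mulr0 (ger0_norm (_ : 0 <= xi - x)); last lra.
have := ler_norm (xi - (x + h)); lra.
Qed.

Let F_right mu x : (mu (half (x + n.+1%:R^-1)) @[n --> \oo] --> mu (half x))%E.
Proof.
have -> : half x = \bigcap_n half (x + n.+1%:R^-1).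
  apply/seteqP; split => [y/= + n _|y /= h].
    by rewrite /half/= !in_itv/= => yx; rewrite (le_trans yx)// lerDl.
  rewrite /half/= in_itv/=; apply/ler_addgt0Pr => e e0.
  have [n ne] := ltr_add_invr e0.
  have := h n I; rewrite /half/= in_itv/= => /le_trans; apply.
  by rewrite lerD2l; move: ne; rewrite add0r => /ltW.
apply: nonincreasing_cvg_mu => //.
- by rewrite (le_lt_trans (probability_le1 _ _))// ltry.
- exact: bigcap_measurable.
- move=> n k nk; apply/subsetPset => y; rewrite /half/= !in_itv/= => yx.
  by rewrite (le_trans yx)// lerD2l lef_pV2 ?posrE// ler_nat.
Qed.

Let half_le mu nu x : e11 mu =1 e11 nu -> (mu (half x) <= nu (half x))%E.
Proof.
move=> e; rewrite -(cvg_lim _ (@F_right nu x))//.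
apply: lime_ge; first by apply/cvg_ex; eexists; exact: F_right.
apply: nearW => n; rewrite -!FK lee_fin.
have h0 : 0 < n.+1%:R^-1 :> R by [].
have := e11_slope_ge mu x h0; have := e11_slope_le nu x h0.
rewrite !e; set h := n.+1%:R^-1 in h0 *; move=> a b.
by rewrite -(ler_pM2l (_ : 0 < 2 * h)); lra.
Qed.

Lemma Q11_positivity mu nu : Q11 mu nu = 0 -> mu = nu.
Proof.
move=> Q0; have e : e11 mu =1 e11 nu.
  move=> x; apply/eqP; rewrite -subr_eq0 -normr_le0 -Q0; exact: Q11_ge.
have halfE x : mu (half x) = nu (half x).
  by apply/le_anti; rewrite !half_le// => y; rewrite e.
apply: P1_eq => A mA; rewrite -lebesgue_stieltjes_cdf_id//.
apply: lebesgue_stieltjes_measure_unique => // I [[a b]] /= _ <-.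
rewrite lebesgue_stieltjes_cdf_id; last exact: measurable_itv.
have -> : `]a, b]%classic = half b `\` half a.
  by rewrite /half -[RHS]setCK setCD setCitvl setUC -[LHS]setCK setCitv.
rewrite !measureD//; try by rewrite -ge0_fin_numE// fin_num_measure.
have [ab|ba] := leP a b.
  by rewrite setIidr; [congr (_ - _)%E; exact: halfE | exact: subset_itvl].
by rewrite setIidl; [congr (_ - _)%E; exact: halfE | apply: subset_itvl; exact: ltW].
Qed.

HB.instance Definition _ := isMetric.Build R (P1 R)
  Q11xx Q11_positivity Q11_sym Q11_triangle.

End Q11_metric.

Lemma mdist_P1E (R : realType) (mu nu : P1 R) : mdist mu nu = Q11 mu nu.
Proof. by []. Qed.

Lemma P1_cauchyP (R : realType) (mu : nat -> P1 R) :
  cauchy (mu @ \oo) <->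
  forall e, 0 < e -> exists N, forall m n,
    (N <= m)%N -> (N <= n)%N -> Q11 (mu m) (mu n) < e.
Proof.
rewrite -cauchy_ballP; split=> h e e0.
  have [[A B] /= [[N _ NA] [M _ MB]] AB] := h e e0.
  exists (maxn N M) => m n; rewrite !geq_max => /andP[? ?] /andP[? ?].
  have := AB (mu m, mu n); rewrite /= ballEmdist/=; apply.
  by split; [exact: NA|exact: MB].
have [N hN] := h e e0; pose tail := mu @` [set n | (N <= n)%N].
exists (tail, tail); first by split; exists N => // n /= ?; exists n.
by move=> [_ _] [/= [m ? <-] [n ? <-]]; rewrite ballEmdist/=; exact: hN.
Qed.

Lemma P1_cvgP (R : realType) (mu : nat -> P1 R) (nu : P1 R) :
  mu @ \oo --> nu <->
  forall e, 0 < e -> exists N, forall n, (N <= n)%N -> Q11 (mu n) nu < e.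
Proof.
split=> [/cvg_ballP h e e0|h].
  have [N _ hN] := h e e0; exists N => n Nn; rewrite Q11_sym.
  by have := hN n Nn; rewrite /= ballEmdist.
apply/cvg_ballP => e e0; have [N hN] := h e e0.
by exists N => // n /= Nn; rewrite ballEmdist/= mdist_P1E Q11_sym; exact: hN.
Qed.

(* Main.v *)
(* The functions [e11 (mu n)] converge uniformly to some [f], which is convex
   and 1-Lipschitz and satisfies [f n + f (- n) - 2 n --> 0].  These properties
   characterize the functions [e11 nu]: if [f'] is the right derivative of [f],
   then [F := (f' + 1) / 2] is a distribution function, and if [p] is its
   Lebesgue-Stieltjes measure, the potential [x |-> int (|xi - x| - |xi|) dp]
   and [f] have increments over [[x, x + h]] that both lie between
   [2 h F(x) - h] and [2 h F(x + h) - h].  Subdividing, their difference is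
   constant.  The asymptotic condition on [f] gives the first moment of [p],
   namely [f 0], by monotone convergence along [min(|xi|, n)]. *)
From HB Require Import structures.
Require Import Defs.
From mathcomp Require Import all_boot all_order all_algebra.
From mathcomp Require Import all_classical all_reals all_analysis.
From mathcomp Require Import measurable_realfun lra.

Set Implicit Arguments.
Unset Strict Implicit.
Unset Printing Implicit Defensive.

Import Order.TTheory GRing.Theory Num.Theory.
Import numFieldNormedType.Exports.

Local Open Scope classical_set_scope.
Local Open Scope ring_scope.

(** * Constancy from small increments *)

(** Cutting [x, y] into n + 1 equal steps and summing bounds [|g y - g x|] by
    [(y - x) (G y - G x) / (n + 1)], which is arbitrarily small. *)
Lemma ler_norm_increment_const (R : realType) (G g : R -> R) :
  (forall x h : R, 0 < h -> `|g (x + h) - g x| <= h * (G (x + h) - G x)) ->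
  forall x y, g x = g y.
Proof.
move=> gG.
have telescope x d m : 0 < d ->
    `|g (x + d *+ m) - g x| <= d * (G (x + d *+ m) - G x).
  move=> d0; elim: m => [|m IH]; first by rewrite mulr0n addr0 !subrr normr0 mulr0.
  have := gG (x + d *+ m) d d0; rewrite -addrA -mulrSr => step.
  rewrite (le_trans (ler_distD (g (x + d *+ m)) _ _))//.
  rewrite (le_trans (lerD step IH))// -mulrDr ler_pM2l//; lra.
have lt x y : x < y -> g x = g y.
  move=> xy; apply/eqP; rewrite eq_sym -subr_eq0 -normr_le0.
  apply/ler_addgt0Pr => e e0; rewrite add0r.
  set C := (y - x) * (G y - G x).
  have [n nC] : exists n : nat, C / e < n.+1%:R.
    by exists (Num.truncn (C / e)); exact: truncnS_gt.
  set d := (y - x) / n.+1%:R.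
  have d0 : 0 < d by rewrite divr_gt0// subr_gt0.
  have yE : x + d *+ n.+1 = y by rewrite -mulr_natr divfK ?pnatr_eq0// addrC subrK.
  have := telescope x d n.+1 d0; rewrite yE => /le_trans; apply.
  rewrite /d mulrAC ler_pdivrMr// -ler_pdivrMl// [e^-1 * _]mulrC.
  exact: ltW nC.
by move=> x y; have [/lt|/lt|->] := ltgtP x y.
Qed.

(** * Potential of a probability on the line *)

Section potential.
Variables (R : realType) (p : probability (measurableTypeR R) R).
Implicit Types (x y h : R) (n : nat).

(* Subtracting [`|xi|] makes the integrand bounded, so that the potential is
   defined without a moment assumption. *)
Definition potential x : R := (\int[p]_xi (`|xi - x| - `|xi|))%R.

Lemma measurable_dist x :
  measurable_fun [set: measurableTypeR R] (fun xi : R => `|xi - x|).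
Proof. by apply: measurableT_comp => //; exact: measurable_funB. Qed.

Lemma integrable_potential x :
  p.-integrable setT (fun xi => (`|xi - x| - `|xi|)%:E).
Proof.
apply: measurable_bounded_integrable => //.
- by rewrite (le_lt_trans (probability_le1 _ _))// ltry.
- by apply: measurable_funB; [exact: measurable_dist|exact: normr_measurable].
exists `|x|; split => // M xM xi _ /=.
rewrite (le_trans _ (ltW xM))// ler_norml.
have := ler_normB xi x; have := ler_normB (xi - x) (- x).
by rewrite opprK subrK normrN => a b; apply/andP; split; lra.
Qed.

Lemma integrable_cstR x : p.-integrable setT (fun=> x%:E).
Proof. exact: (finite_measure_integrable_cst p x). Qed.

Lemma Rintegral_cstR x : (\int[p]_xi x)%R = x.
Proof. by rewrite Rintegral_cst//= probability_setT /= mulr1. Qed.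

Lemma integrableDR (f g : R -> R) :
  p.-integrable setT (fun xi => (f xi)%:E) ->
  p.-integrable setT (fun xi => (g xi)%:E) ->
  p.-integrable setT (fun xi => (f xi + g xi)%:E).
Proof. by move=> hf hg; exact: (integrableD _ hf hg). Qed.

Local Notation half x := (`]-oo, x]%classic : set (measurableTypeR R)).
Local Notation F x := (fine (p (half x))).

Let indic_integrable x :
  p.-integrable setT (fun xi => (\1_(half x) xi : R)%:E).
Proof. exact: integrable_indic. Qed.

Let indic_itv_integrable x h :
  p.-integrable setT (fun xi => (2 * h * \1_(half x) xi)%:E).
Proof. exact: (integrableZl measurableT (2 * h) (indic_integrable x)). Qed.

Let Rintegral_indic_itv x h :
  (\int[p]_xi (2 * h * \1_(half x) xi))%R = 2 * h * F x.
Proof.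
rewrite (RintegralZl (f := \1_(half x)))//; last exact: indic_integrable.
by rewrite /Rintegral integral_indic// setIT.
Qed.

(** Integrates a pointwise inequality that is an equality for [xi > x + h] and reduces to
    [x - xi <= |xi - x|] otherwise. *)
Lemma potential_slope_le x h : 0 < h ->
  potential (x + h) + h <= potential x + 2 * h * F (x + h).
Proof.
move=> h0; rewrite -{2}(Rintegral_cstR h) -Rintegral_indic_itv /potential.
rewrite -!RintegralD//; try exact: integrable_potential;
  try exact: integrable_cstR; last exact: indic_itv_integrable.
apply: le_Rintegral => //.
- by apply: integrableDR; [exact: integrable_potential|exact: integrable_cstR].
- apply: integrableDR; first exact: integrable_potential.
  exact: indic_itv_integrable.
move=> xi _; rewrite indicE mem_setE in_itv/=.
have [xix|xix] := leP xi (x + h).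
  rewrite mulr1 (ler0_norm (_ : xi - (x + h) <= 0)) ?subr_le0//.
  have := ler_norm (- (xi - x)); rewrite normrN; lra.
by rewrite mulr0 !(@ger0_norm _ (xi - _)); lra.
Qed.

(** Here equality holds for [xi <= x], and [xi - (x + h) <= |xi - (x + h)|] settles the rest. *)
Lemma potential_slope_ge x h : 0 < h ->
  potential x + 2 * h * F x <= potential (x + h) + h.
Proof.
move=> h0; rewrite -{3}(Rintegral_cstR h) -Rintegral_indic_itv /potential.
rewrite -!RintegralD//; try exact: integrable_potential;
  try exact: integrable_cstR; last exact: indic_itv_integrable.
apply: le_Rintegral => //.
- apply: integrableDR; first exact: integrable_potential.
  exact: indic_itv_integrable.
- by apply: integrableDR; [exact: integrable_potential|exact: integrable_cstR].
move=> xi _; rewrite indicE mem_setE in_itv/=.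
have [xix|xix] := leP xi x.
  by rewrite mulr1 !(@ler0_norm _ (xi - _)); lra.
rewrite mulr0 (ger0_norm (_ : 0 <= xi - x)); last lra.
by have := ler_norm (xi - (x + h)); lra.
Qed.

(** Convexity without division: [2 F(x + h) - 1] separates the slopes over the two adjacent
    intervals. *)
Lemma potential_three_slopes x h k : 0 < h -> 0 < k ->
  k * (potential (x + h) - potential x) <=
  h * (potential (x + h + k) - potential (x + h)).
Proof.
move=> h0 k0; have := potential_slope_le x h0.
have := potential_slope_ge (x + h) k0; set P := fine _ => a b.
have : k * (potential (x + h) + h) <= k * (potential x + 2 * h * P).
  by rewrite ler_pM2l.
have : h * (potential (x + h) + 2 * k * P) <= h * (potential (x + h + k) + k).
  by rewrite ler_pM2l.
nra.
Qed.

(** Follows from [|xi - n| + |xi + n| = 2 max(|xi|, n)] and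
    [min(|xi|, n) + max(|xi|, n) = |xi| + n]. *)
Lemma Rintegral_minr_norm n :
  (\int[p]_xi Num.min `|xi| n%:R)%R =
  n%:R - (potential n%:R + potential (- n%:R)) / 2.
Proof.
have E (xi : R) : Num.min `|xi| n%:R =
    n%:R + (- 2^-1) * ((`|xi - n%:R| - `|xi|) + (`|xi - - n%:R| - `|xi|)).
  have n0 : 0 <= n%:R :> R by [].
  rewrite opprK; have [xn|nx] := leP `|xi| n%:R.
    move: (xn); rewrite ler_norml => /andP[? ?].
    by rewrite (ler0_norm (_ : xi - _ <= 0)) ?(ger0_norm (_ : 0 <= xi + _)); lra.
  have [xi0|xi0] := leP 0 xi.
    move: nx; rewrite ger0_norm// => nx.
    by rewrite !ger0_norm; lra.
  by move: nx; rewrite ltr0_norm// => nx; rewrite !ltr0_norm; lra.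
under eq_Rintegral do rewrite E.
have i2 := integrableDR (integrable_potential n%:R) (integrable_potential (- n%:R)).
rewrite RintegralD//; [|exact: integrable_cstR|exact: (integrableZl _ _ i2)].
rewrite Rintegral_cstR RintegralZl// RintegralD//;
  [|exact: integrable_potential|exact: integrable_potential].
rewrite -!/(potential _); lra.
Qed.

(** The limit is taken in the extended reals and may be [+oo]; computing it as a real number proves
    that the first moment is finite. *)
Lemma cvg_potential_moment :
  (n%:R - (potential n%:R + potential (- n%:R)) / 2)%:E @[n --> \oo] -->
  (\int[p]_xi `|xi|%:E)%E.
Proof.
have mmin n : measurable_fun [set: measurableTypeR R] (fun xi : R => Num.min `|xi| n%:R).
  by apply: measurable_minr => //; exact: normr_measurable.
have -> : (fun n => (n%:R - (potential n%:R + potential (- n%:R)) / 2)%:E) =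
    (fun n => \int[p]_xi (Num.min `|xi| n%:R)%:E)%E.
  apply/funext => n; rewrite -Rintegral_minr_norm /Rintegral fineK//.
  apply: integrable_fin_num => //.
  apply: measurable_bounded_integrable => //.
    by rewrite (le_lt_trans (probability_le1 _ _))// ltry.
  exists n%:R; split => // M nM xi _ /=.
  rewrite [`|Num.min _ _|]ger0_norm ?le_min ?normr_ge0 ?ler0n//.
  by rewrite ge_min (ltW nM) orbT.
pose g n (xi : measurableTypeR R) := (Num.min `|xi| n%:R)%:E.
(* The sequence is constant once n reaches [|xi|]. *)
have gE (xi : measurableTypeR R) : g ^~ xi @ \oo --> `|xi|%:E.
  apply: cvg_near_cst; near=> n; rewrite /g min_l//.
  by near: n; exact: nbhs_infty_ger.
under eq_integral => xi _ do rewrite -(cvg_lim _ (gE xi))//.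
apply: cvg_monotone_convergence => //.
- by move=> n; apply/measurable_EFinP; exact: mmin.
- by move=> n xi _; rewrite lee_fin le_min normr_ge0/=.
- move=> xi _ m n mn; rewrite lee_fin le_min ge_min lexx/=.
  by rewrite ge_min ler_nat mn orbT.
Unshelve. all: by end_near. Qed.

End potential.

Lemma potential_e11 (R : realType) (mu : P1 R) (x : R) :
  potential mu x = e11 mu x - e11 mu 0.
Proof.
rewrite /potential /e11 RintegralB//.
- by congr (_ - _); apply: eq_Rintegral => xi _; rewrite subr0.
- exact: P1_integrable_dist.
- apply: eq_integrable (P1_integrable_dist mu 0) => // xi _.
  by rewrite subr0.
Qed.

(** * Reconstruction of a measure from a convex function *)

Section right_slope.
Variables (R : realType) (f : R -> R).
Hypothesis f_lip : forall x h : R, 0 < h -> `|f (x + h) - f x| <= h.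
Hypothesis f_convex : forall x h k : R, 0 < h -> 0 < k ->
  k * (f (x + h) - f x) <= h * (f (x + h + k) - f (x + h)).
Implicit Types (x y h : R).

(* If [f] is the potential of a probability with distribution function [F],
   then its right derivative is [2 F - 1]. *)
Let slope x h := (f (x + h) - f x + h) / (2 * h).

(** By convexity [slope x h] is nondecreasing in [h], so this infimum is the limit at 0+, namely
    [(f' + 1) / 2] for the right derivative [f']. *)
Definition slope_cdf x : R := inf [set slope x h | h in [set h | 0 < h]].

Let slope_ge0 x h : 0 < h -> 0 <= slope x h.
Proof.
move=> h0; rewrite divr_ge0//; last by rewrite mulr_ge0// ltW.
by have := f_lip x h0; rewrite ler_norml => /andP[+ _]; lra.
Qed.

Let slope_cdf_le x h : 0 < h -> slope_cdf x <= slope x h.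
Proof.
move=> h0; apply: ge_inf; last by exists h.
by exists 0 => _ [k /= k0 <-]; exact: slope_ge0.
Qed.

Let le_slope_cdf x c : (forall h, 0 < h -> c <= slope x h) -> c <= slope_cdf x.
Proof.
move=> H; apply: lb_le_inf; first by exists (slope x 1), 1 => /=.
by move=> _ [h /= h0 <-]; exact: H.
Qed.

Lemma slope_cdf_ge0 x : 0 <= slope_cdf x.
Proof. by apply: le_slope_cdf => h; exact: slope_ge0. Qed.

Lemma slope_cdf_le1 x : slope_cdf x <= 1.
Proof.
rewrite (le_trans (slope_cdf_le x ltr01))// /slope mulr1 ler_pdivrMr//.
by have := f_lip x ltr01; rewrite ler_norml => /andP[_]; lra.
Qed.

Lemma slope_cdf_lower x h : 0 < h -> f x + 2 * h * slope_cdf x <= f (x + h) + h.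
Proof.
move=> h0; have := slope_cdf_le x h0.
by rewrite /slope ler_pdivlMr ?mulr_gt0// => a; lra.
Qed.

(** Convexity gives [slope x h <= slope (x + h) k] for all [k > 0]; then take the infimum over
    [k]. *)
Lemma slope_cdf_upper x h : 0 < h ->
  f (x + h) + h <= f x + 2 * h * slope_cdf (x + h).
Proof.
move=> h0; suff: slope x h <= slope_cdf (x + h).
  by rewrite /slope ler_pdivrMr ?mulr_gt0// => a; lra.
apply: le_slope_cdf => k k0.
rewrite /slope ler_pdivrMr ?mulr_gt0// mulrAC ler_pdivlMr ?mulr_gt0//.
by have := f_convex x h0 k0; nra.
Qed.

Lemma slope_cdf_nondecreasing : nondecreasing slope_cdf.
Proof.
move=> x y; rewrite le_eqVlt => /predU1P[->//|xy].
have h0 : 0 < y - x by rewrite subr_gt0.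
have := slope_cdf_lower x h0; have := slope_cdf_upper x h0.
rewrite (addrC x) subrK => a b.
by rewrite -(ler_pM2l (_ : 0 < 2 * (y - x))); lra.
Qed.

(** An infimum of functions continuous in [x] is upper semicontinuous; with monotonicity this gives
    right continuity. *)
Lemma slope_cdf_right_continuous : right_continuous slope_cdf.
Proof.
move=> x; apply/cvgrPdist_le => e e0.
have : slope_cdf x < slope_cdf x + e / 2 by rewrite ltrDl divr_gt0.
move=> /inf_lt[|_ [h /= h0 <-] hx]; first by exists (slope x 1), 1 => /=.
near=> y.
have xy : x < y by near: y; exact: nbhs_right_gt.
(* As [f] is 1-Lipschitz, moving the base point by d changes [slope _ h] by at most d / h, here less
   than e / 2. *)
have yx : y < x + e * h / 2.
  by near: y; apply: nbhs_right_lt; rewrite ltrDl divr_gt0// mulr_gt0.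
rewrite distrC ger0_norm ?subr_ge0; last exact/slope_cdf_nondecreasing/ltW.
rewrite lerBlDl; apply: (le_trans (slope_cdf_le y h0)).
suff : slope y h <= slope x h + e / 2 by lra.
rewrite /slope -[e / 2](mulfK (_ : 2 * h != 0)); last by rewrite mulf_neq0// gt_eqF.
rewrite -mulrDl ler_pM2r ?invr_gt0 ?mulr_gt0//.
have d0 : 0 < y - x by rewrite subr_gt0.
have := f_lip x d0; have := f_lip (x + h) d0.
rewrite addrAC (addrC x) subrK !ler_norml => /andP[_ a] /andP[b _].
nra.
Unshelve. all: by end_near. Qed.

Hypothesis f_asym : f n%:R + f (- n%:R) - 2 * n%:R @[n --> \oo] --> 0.

Let gap n : R := f n%:R + f (- n%:R) - 2 * n%:R.

(** The decrease [gap n - gap n.+1] is the sum of 1 minus the slope of [f] on [n, n + 1] and 1 plus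
    its slope on [- n - 1, - n]. Both terms are nonnegative; the first dominates twice the upper
    tail, the second twice the lower tail. *)
Let tail_upper n : 1 - slope_cdf n.+1%:R <= (gap n - gap n.+1) / 2.
Proof.
have := slope_cdf_upper n%:R ltr01; have := f_lip (- n.+1%:R) ltr01.
rewrite /gap -natr1 [- (n%:R + 1)]opprD subrK ler_norml => /andP[a b] c; lra.
Qed.

Let tail_lower n : slope_cdf (- n.+1%:R) <= (gap n - gap n.+1) / 2.
Proof.
have := slope_cdf_lower (- n.+1%:R) ltr01; have := f_lip n%:R ltr01.
rewrite /gap -natr1 [- (n%:R + 1)]opprD subrK ler_norml => /andP[a b] c; lra.
Qed.

Let gap_small (e : R) : 0 < e -> exists n, (gap n - gap n.+1) / 2 <= e.
Proof.
move=> e0; have /cvgrPdist_le/(_ e e0)[N _ HN] := f_asym.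
exists N; have := HN N (leqnn _); have := HN N.+1 (leqnSn _).
rewrite /= -!/(gap _) !sub0r !normrN !ler_norml => /andP[a b] /andP[c d]; lra.
Qed.

Lemma slope_cdf_cvgNy : slope_cdf @ -oo --> (0 : R).
Proof.
apply/cvgrPdist_le => e e0; have [n ne] := gap_small e0.
near=> x; rewrite sub0r normrN ger0_norm ?slope_cdf_ge0//.
apply: le_trans ne; apply: le_trans (tail_lower n).
by apply: slope_cdf_nondecreasing; near: x; exact: nbhs_ninfty_le.
Unshelve. all: by end_near. Qed.

Lemma slope_cdf_cvgy : slope_cdf @ +oo --> (1 : R).
Proof.
apply/cvgrPdist_le => e e0; have [n ne] := gap_small e0.
near=> x; rewrite ger0_norm ?subr_ge0 ?slope_cdf_le1//.
apply: le_trans ne; apply: le_trans (tail_upper n); rewrite lerD2l lerN2.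
by apply: slope_cdf_nondecreasing; near: x; exact: nbhs_pinfty_ge.
Unshelve. all: by end_near. Qed.

#[local] HB.instance Definition _ := isCumulative.Build R _ R slope_cdf
  slope_cdf_nondecreasing slope_cdf_right_continuous.

(** The limits 0 and 1 give the Lebesgue-Stieltjes measure total mass 1, whence the type of
    [lsf]. *)
#[local] HB.instance Definition _ := isCumulativeBounded.Build R 0 1 slope_cdf
  slope_cdf_cvgNy slope_cdf_cvgy.

Let lsf : probability (measurableTypeR R) R := lebesgue_stieltjes_measure slope_cdf.

Let lsf_itv x : fine (lsf `]-oo, x]%classic) = slope_cdf x.
Proof.
have := cdf_lebesgue_stieltjes_id slope_cdf x.
by rewrite /cdf /distribution /pushforward preimage_id => ->.
Qed.

Let potential_lsf x : potential lsf x = f x - f 0.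
Proof.
suff : potential lsf x - f x = potential lsf 0 - f 0.
  have -> : potential lsf 0 = 0.
    by rewrite /potential; under eq_Rintegral do rewrite subr0 subrr;
      rewrite Rintegral_cstR.
  lra.
(* Both increments over [y, y + h] lie in one interval of length [2 h (F(y + h) - F(y))], hence the
   choice [G = 2 F]. *)
apply: (@ler_norm_increment_const _ (fun y => 2 * slope_cdf y)
  (fun y => potential lsf y - f y)) => y h h0.
have := potential_slope_le lsf y h0; have := potential_slope_ge lsf y h0.
rewrite /= !lsf_itv => a b.
have c := slope_cdf_lower y h0; have d := slope_cdf_upper y h0.
by rewrite ler_norml; apply/andP; split; lra.
Qed.

Lemma e11_of_convex : exists nu : P1 R, forall x, e11 nu x = f x.
Proof.
have moment : (\int[lsf]_xi `|xi|%:E = (f 0)%:E)%E.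
  have mc := @cvg_potential_moment R lsf.
  suff fc : (n%:R - (potential lsf n%:R + potential lsf (- n%:R)) / 2)%:E
      @[n --> \oo] --> (f 0)%:E by exact: (cvg_unique _ mc fc).
  (* The two potentials average to [(f n + f (- n)) / 2 - f 0]. *)
  have -> : (fun n => (n%:R - (potential lsf n%:R + potential lsf (- n%:R)) / 2)%:E) =
      (fun n => (f 0 - gap n / 2)%:E).
    by apply/funext => n /=; rewrite !potential_lsf /gap; congr EFin; lra.
  apply/cvg_EFin; first by near=> n.
  have half_gap : gap n / 2 @[n --> \oo] --> 0.
    by rewrite -(mul0r 2^-1); exact: cvgMl.
  rewrite -[X in _ --> X]subr0; apply: cvgB half_gap; exact: cvg_cst.
(* [nu] agrees with [lsf] on Borel sets and vanishes off them, as [P1] demands. *)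
have [|nu nuE] := @P1_repr R lsf; first by rewrite moment ltry.
have e0 : e11 nu 0 = f 0.
  rewrite /e11 /Rintegral; under eq_integral do rewrite subr0.
  by rewrite (eq_measure_integral lsf) ?moment// => A mA _; exact: nuE.
(* The potential determines [f] up to a constant, fixed by agreement at 0. *)
exists nu => x; apply: (addIr (- f 0)); rewrite -{1}e0 -potential_e11 -potential_lsf.
by rewrite /potential /Rintegral (eq_measure_integral lsf)// => A mA _; exact: nuE.
Unshelve. all: by end_near. Qed.

End right_slope.

(** * Shape of the functions [e11 mu] *)

Section e11_shape.
Variable R : realType.
Implicit Types (mu nu : P1 R).

Lemma e11_lip_norm mu (x h : R) : 0 < h -> `|e11 mu (x + h) - e11 mu x| <= h.
Proof.
move=> h0; have := e11_lip mu (x + h) x; have := e11_lip mu x (x + h).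
have -> : x + h - x = h by lra.
have -> : x - (x + h) = - h by lra.
by rewrite normrN gtr0_norm// ler_norml => a b; apply/andP; split; lra.
Qed.

Lemma e11_three_slopes mu (x h k : R) : 0 < h -> 0 < k ->
  k * (e11 mu (x + h) - e11 mu x) <= h * (e11 mu (x + h + k) - e11 mu (x + h)).
Proof.
move=> h0 k0; have := potential_three_slopes mu x h0 k0.
by rewrite !potential_e11 => a; nra.
Qed.

(** The truncated moments equal [e11 mu 0] minus half of the expression here, and they tend to the
    first moment, again [e11 mu 0]. *)
Lemma cvg_e11_gap mu :
  e11 mu n%:R + e11 mu (- n%:R) - 2 * n%:R @[n --> \oo] --> (0 : R).
Proof.
have := @cvg_potential_moment R mu.
have -> : (\int[mu]_xi `|xi|%:E = (e11 mu 0)%:E)%E.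
  rewrite /e11 /Rintegral; under [in RHS]eq_integral do rewrite subr0.
  rewrite fineK//; apply: integrable_fin_num => //.
  by apply: eq_integrable (P1_integrable_dist mu 0) => // xi _; rewrite subr0.
move=> /fine_cvg/= c.
have -> : (fun n => e11 mu n%:R + e11 mu (- n%:R) - 2 * n%:R) =
  (fun n => 2 * (e11 mu 0 - (n%:R - (potential mu n%:R + potential mu (- n%:R)) / 2))).
  by apply/funext => n; rewrite !potential_e11; lra.
have zeroE : 0 = 2 * (e11 mu 0 - e11 mu 0) by rewrite subrr mulr0.
rewrite [X in _ --> X]zeroE.
apply: cvgMr; apply: cvgB c; exact: cvg_cst.
Qed.

End e11_shape.

(** * Limit of a Cauchy sequence *)

Theorem proposition4p3 (R : realType) (mu : nat -> P1 R) :
  cauchy (mu @ \oo) -> exists nu : P1 R, mu @ \oo --> nu.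
Proof.
move=> /P1_cauchyP mu_cauchy.
have cvg_e11 x : cvg (e11 (mu n) x @[n --> \oo]).
  apply/cauchy_cvgP/cauchy_exP => e e0.
  have [N HN] := mu_cauchy e e0; exists (e11 (mu N) x); exists N => // n /= Nn.
  by rewrite /ball/= (le_lt_trans (Q11_ge _ _ _))// HN.
pose f x : R := limn (fun n => e11 (mu n) x).
have f_cvg x : e11 (mu n) x @[n --> \oo] --> f x by exact: cvg_e11.
(* The Cauchy index N serves all x at once; letting m tend to infinity weakens [<] to [<=]. *)
have f_unif (e : R) : 0 < e -> exists N, forall n x, (N <= n)%N -> `|e11 (mu n) x - f x| <= e.
  move=> e0; have [N HN] := mu_cauchy e e0; exists N => n x Nn.
  have c : `|e11 (mu n) x - e11 (mu m) x| @[m --> \oo] --> `|e11 (mu n) x - f x|.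
    by apply: cvg_norm; apply: cvgB; [exact: cvg_cst|exact: f_cvg].
  apply: (ler_cvg_to c (cvg_cst e)); near=> m.
  rewrite (le_trans (Q11_ge _ _ _))// ltW// HN//.
  by near: m; exact: nbhs_infty_ge.
have [nu nuE] : exists nu : P1 R, forall x, e11 nu x = f x.
  apply: e11_of_convex.
  - move=> x h h0.
    have c : `|e11 (mu n) (x + h) - e11 (mu n) x| @[n --> \oo] --> `|f (x + h) - f x|.
      by apply: cvg_norm; apply: cvgB; exact: f_cvg.
    by apply: (ler_cvg_to c (cvg_cst h)); apply: nearW => n; exact: e11_lip_norm.
  - move=> x h k h0 k0.
    have c y z a : a * (e11 (mu n) y - e11 (mu n) z) @[n --> \oo] --> a * (f y - f z).
      by apply: cvgMr; apply: cvgB; exact: f_cvg.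
    apply: (ler_cvg_to (c _ _ _) (c _ _ _)).
    by apply: nearW => n; exact: e11_three_slopes.
  - apply/cvgrPdist_le => e e0.
    (* One third for the gap of [mu N], one for each error at n and - n; by uniformity N does not
       depend on n. *)
    have e3 : 0 < e / 3 by rewrite divr_gt0.
    have [N HN] := f_unif _ e3.
    have /cvgrPdist_le/(_ _ e3) := cvg_e11_gap (mu N).
    apply: filterS => n; have := HN N n%:R (leqnn _); have := HN N (- n%:R) (leqnn _).
    rewrite !sub0r !normrN !ler_norml => /andP[? ?] /andP[? ?] /andP[? ?].
    by apply/andP; split; lra.
exists nu; apply/P1_cvgP => e e0.
(* Halving e makes the bound on the supremum strict. *)
have e2 : 0 < e / 2 by rewrite divr_gt0.
have [N HN] := f_unif _ e2.
exists N => n Nn; apply: (@le_lt_trans _ _ (e / 2)); last lra.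
by apply: Q11_le => x; rewrite nuE; exact: HN.
Unshelve. all: by end_near. Qed.
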